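(* The size of the Graver basis $\operatorname{Gr}_A$, or of the universal Markov basis $\mathcal{M}_A$, of a toric ideal $I_A$ cannot be bounded above by a function of the size of the universal Gröbner basis $\mathcal{U}_A$ or of the set of circuits $\mathcal{C}_A$ of $I_A$. That is, for each choice of $X\in\{\operatorname{Gr},\mathcal{M}\}$ and $Y\in\{\mathcal{U},\mathcal{C}\}$, there is no function $\varphi:\mathbb{N}\to\mathbb{N}$ such that $|X_A|\le\varphi(|Y_A|)$ for every finite nonempty set $A$ of positive integers.
   Context: $\mathbb{K}$ is an arbitrary field and $\mathbb{N}$ contains $0$. For a finite set $A=\{a_1,\ldots,a_n\}$ of positive integers, the $A$-degree of $\mathbf{x}^{\mathbf{u}}=x_1^{u_1}\cdots x_n^{u_n}$ is $u_1a_1+\cdots+u_na_n$, and the toric ideal of $A$ is $I_A=\langle \mathbf{x}^{\mathbf{u}}-\mathbf{x}^{\mathbf{v}}\mid \deg_A(\mathbf{x}^{\mathbf{u}})=\deg_A(\mathbf{x}^{\mathbf{v}})\rangle\subseteq\mathbb{K}[x_1,\ldots,x_n]$. In all the sets below, a binomial is identified with its opposite; the size of such a set is its number of elements. - The universal Markov basis $\mathcal{M}_A$ is the union of all Markov bases of $I_A$, a Markov basis being a generating set of $I_A$ consisting of binomials $\mathbf{x}^{\mathbf{u}}-\mathbf{x}^{\mathbf{v}}\in I_A$ that is minimal with respect to inclusion. - The Graver basis $\operatorname{Gr}_A$ is the set of primitive binomials, where a nonzero binomial $\mathbf{x}^{\mathbf{u}}-\mathbf{x}^{\mathbf{v}}\in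 I_A$ is primitive if there is no other nonzero binomial $\mathbf{x}^{\mathbf{w}}-\mathbf{x}^{\mathbf{z}}\in I_A$ with $\mathbf{x}^{\mathbf{w}}\mid\mathbf{x}^{\mathbf{u}}$ and $\mathbf{x}^{\mathbf{z}}\mid\mathbf{x}^{\mathbf{v}}$. - The universal Gröbner basis $\mathcal{U}_A$ is the union of all reduced Gröbner bases of $I_A$ over all monomial orders. - Circuits $\mathcal{C}_A$: a binomial $\mathbf{x}^{\mathbf{u}}-\mathbf{x}^{\mathbf{v}}\in I_A$ is irreducible if $\operatorname{supp}(\mathbf{u})\cap\operatorname{supp}(\mathbf{v})=\emptyset$ (with $\operatorname{supp}(\mathbf{u})=\{i\mid u_i\neq0\}$) and the nonzero entries of $\mathbf{u}+\mathbf{v}$ are relatively prime; $\mathcal{C}_A$ is the set of irreducible binomials whose support $\operatorname{supp}(\mathbf{u})\cup\operatorname{supp}(\mathbf{v})$ is inclusion-minimal among nonzero binomials of $I_A$. Equivalently, $\mathcal{C}_A=\{x_i^{a_j/\gcd(a_i,a_j)}-x_j^{a_i/\gcd(a_i,a_j)}\mid i\neq j\}$. *)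

(* Defs.v *)
From mathcomp Require Import all_boot all_order all_algebra finmap.
From mathcomp Require Import boolp classical_sets functions cardinality.
From mathcomp Require Import mpoly.

Set Implicit Arguments.
Unset Strict Implicit.
Unset Printing Implicit Defensive.

Import GRing.Theory.

Local Open Scope classical_set_scope.
Local Open Scope ring_scope.

Definition ideal_gen (R : comNzRingType) (S : set R) : set R :=
  [set f | exists s : seq (R * R),
      (forall p, p \in s -> S p.2) /\ f = \sum_(p <- s) p.1 * p.2].

Definition adeg n (a : n.-tuple nat) (u : 'X_{1..n}) : nat :=
  (\sum_(i < n) u i * tnth a i)%N.

Definition binom (K : fieldType) n (u v : 'X_{1..n}) : {mpoly K[n]} :=
  'X_[u] - 'X_[v].

Definition toric_ideal (K : fieldType) n (a : n.-tuple nat) :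
    set {mpoly K[n]} :=
  ideal_gen [set f | exists u v, adeg a u = adeg a v /\ f = binom K u v].

Definition markov_basis (K : fieldType) n (a : n.-tuple nat)
    (G : set {mpoly K[n]}) : Prop :=
  [/\ forall f, G f -> toric_ideal a f /\ exists u v, f = binom K u v,
      ideal_gen G = toric_ideal a
    & forall H, H `<=` G -> ideal_gen H = toric_ideal a -> H = G].

Definition universal_markov (K : fieldType) n (a : n.-tuple nat) :
    set {mpoly K[n]} :=
  \bigcup_(G in @markov_basis K n a) G.

Definition primitive (K : fieldType) n (a : n.-tuple nat)
    (u v : 'X_{1..n}) : Prop :=
  [/\ toric_ideal a (binom K u v),
      binom K u v != 0
    & forall w z, toric_ideal a (binom K w z) -> binom K w z != 0 ->
        (w <= u)%MM -> (z <= v)%MM -> binom K w z = binom K u v].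

Definition graver (K : fieldType) n (a : n.-tuple nat) : set {mpoly K[n]} :=
  [set f | exists u v, f = binom K u v /\ primitive K a u v].

(* [le] is the weak order; being a well-order follows from these conditions
   by Dickson's lemma. *)
Definition monomial_order n (le : rel 'X_{1..n}) : Prop :=
  [/\ antisymmetric le, transitive le, total le,
      forall m, le 0%MM m
    & forall m1 m2 m, le m1 m2 -> le (m1 + m)%MM (m2 + m)%MM].

(* Never holds for [f = 0], whose support is empty. *)
Definition leading (K : fieldType) n (le : rel 'X_{1..n})
    (f : {mpoly K[n]}) (m : 'X_{1..n}) : Prop :=
  m \in msupp f /\ forall m', m' \in msupp f -> le m' m.

Definition initial_ideal (K : fieldType) n (le : rel 'X_{1..n})
    (S : set {mpoly K[n]}) : set {mpoly K[n]} :=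
  ideal_gen [set g | exists f m, [/\ S f, leading le f m & g = 'X_[m]]].

Definition groebner_basis (K : fieldType) n (le : rel 'X_{1..n})
    (I G : set {mpoly K[n]}) : Prop :=
  [/\ finite_set G, G `<=` I & initial_ideal le G = initial_ideal le I].

Definition reduced_groebner_basis (K : fieldType) n (le : rel 'X_{1..n})
    (I G : set {mpoly K[n]}) : Prop :=
  [/\ groebner_basis le I G,
      forall g, G g -> exists m, leading le g m /\ g@_m = 1
    & forall g h m m', G g -> G h -> g <> h ->
        leading le g m -> m' \in msupp h -> ~~ (m <= m')%MM].

Definition universal_groebner (K : fieldType) n (a : n.-tuple nat) :
    set {mpoly K[n]} :=
  [set f | exists le G, [/\ monomial_order le,
      reduced_groebner_basis le (toric_ideal a) G & G f]].

Definition mnm_supp n (u : 'X_{1..n}) : {set 'I_n} :=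
  [set i | u i != 0%N]%SET.

(* The empty gcd is 0, so the zero binomial is not irreducible. *)
Definition irreducible_binom (K : fieldType) n (a : n.-tuple nat)
    (u v : 'X_{1..n}) : Prop :=
  [/\ toric_ideal a (binom K u v),
      [disjoint mnm_supp u & mnm_supp v]%B
    & \big[gcdn/0%N]_(i < n | (u + v)%MM i != 0%N) (u + v)%MM i = 1%N].

Definition circuits (K : fieldType) n (a : n.-tuple nat) :
    set {mpoly K[n]} :=
  [set f | exists u v, [/\ f = binom K u v,
      irreducible_binom K a u v
    & forall w z, toric_ideal a (binom K w z) -> binom K w z != 0 ->
        ~~ (mnm_supp w :|: mnm_supp z \proper
            mnm_supp u :|: mnm_supp v)%SET]].

(* [S] has exactly [m] elements when each [f] is identified with [- f]. *)
Definition size_upto_sign (K : fieldType) n (S : set {mpoly K[n]}) (m : nat) :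
    Prop :=
  ([set ([set f; - f] : set {mpoly K[n]}) | f in S] #= `I_m)%card.

(* The i-th variable corresponds to the i-th smallest element of [A]. *)
Definition elements (A : {fset nat}) : (size (sort leq A)).-tuple nat :=
  in_tuple (sort leq A).

Definition size_bounded_by (K : fieldType)
    (X Y : forall n, n.-tuple nat -> set {mpoly K[n]}) (phi : nat -> nat) :
    Prop :=
  forall A : {fset nat}, A != fset0 -> 0%N \notin A ->
  forall x y : nat, size_upto_sign (X _ (elements A)) x ->
    size_upto_sign (Y _ (elements A)) y -> (x <= phi y)%N.

(* Main.v *)
Require Import Defs.
From mathcomp Require Import all_boot all_order all_algebra finmap.
From mathcomp Require Import boolp classical_sets functions cardinality.
From mathcomp Require Import mpoly zify.

Set Implicit Arguments.
Unset Strict Implicit.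
Unset Printing Implicit Defensive.

Import GRing.Theory.

Local Open Scope classical_set_scope.
Local Open Scope ring_scope.

(** The sets A = {1, 2, 2k} with k > 1 show that no bound exists. Write x, y, z
    for the variables of degrees 1, 2 and 2k. The fiber of degree 2k consists of
    z and the monomials x^s y^t with s + 2t = 2k, so s is even there.

    - Each of the k + 1 binomials z - x^{2i} y^{k-i}, together with x^2 - y, is a
      Markov basis: modulo these two, every monomial becomes the power of x of
      the same degree ([toric_generated]), and neither of them can be dropped,
      as suitable points of K^3 show ([fiber_binom_markov]). Each is also
      primitive, since z is a variable ([fiber_binom_graver]). Hence both
      invariants grow with k.

    - Any two distinct monomials u, v of the same degree are respectively
      divisible by the two terms of x^2 - y or of one of the binomials
      z - x^{2i} y^{k-i}, in one order or the other ([graver_pair_exists]).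
      An element u - v of the universal Groebner basis has u a minimal
      generator of the initial ideal and v standard, which forces u - v to be
      one of these binomials up to sign. The intermediate ones, 0 < i < k, are
      excluded: x^2 - y puts x^2 or y in the initial ideal, and both properly
      divide x^{2i} y^{k-i} ([universal_groebner_pure]). For circuits,
      minimality of the support against x^2 - y excludes the same binomials
      ([circuits_pure]). So both sets are contained in
      {x^2 - y, z - x^{2k}, z - y^k} up to sign, whatever k is.

    A function phi would then have to bound every k by one of phi 0, ..., phi 3.
    The sizes of the Graver and universal Markov bases are defined because both
    consist of binomials of degree at most 2k; for Markov bases this comes from
    a homogeneity argument ([markov_basis_bounded]). *)

(** * Ideals generated by a set *)

Lemma mem_ideal_gen (R : comNzRingType) (S : set R) (f : R) :
  S f -> ideal_gen S f.
Proof.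
move=> Sf; exists [:: (1, f)]; split; first by move=> p; rewrite inE => /eqP ->.
by rewrite big_seq1 mul1r.
Qed.

Lemma ideal_genD (R : comNzRingType) (S : set R) (f g : R) :
  ideal_gen S f -> ideal_gen S g -> ideal_gen S (f + g).
Proof.
move=> [s [Ss ->]] [t [St ->]]; exists (s ++ t); split; last by rewrite big_cat.
by move=> p; rewrite mem_cat => /orP[/Ss|/St].
Qed.

Lemma ideal_genM (R : comNzRingType) (S : set R) (f g : R) :
  ideal_gen S g -> ideal_gen S (f * g).
Proof.
move=> [s [Ss ->]]; exists [seq (f * p.1, p.2) | p <- s]; split.
  by move=> p /mapP[q /Ss Sq ->].
by rewrite big_map mulr_sumr; apply: eq_bigr => p _; rewrite mulrA.
Qed.

Lemma ideal_genB (R : comNzRingType) (S : set R) (f g : R) :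
  ideal_gen S f -> ideal_gen S g -> ideal_gen S (f - g).
Proof. by move=> Sf Sg; rewrite -mulN1r; apply/ideal_genD/ideal_genM. Qed.

Lemma ideal_gen0 (R : comNzRingType) (S : set R) : ideal_gen S 0.
Proof. by exists [::]; rewrite big_nil. Qed.

Lemma ideal_gen_sum (R : comNzRingType) (S : set R) (T : eqType) (r : seq T)
    (F : T -> R) :
  (forall p, p \in r -> ideal_gen S (F p)) -> ideal_gen S (\sum_(p <- r) F p).
Proof.
elim: r => [|p r IHr] SF; first by rewrite big_nil; apply: ideal_gen0.
rewrite big_cons; apply: ideal_genD; first by apply: SF; rewrite inE eqxx.
by apply: IHr => q rq; apply: SF; rewrite inE rq orbT.
Qed.

Lemma ideal_gen_sub (R : comNzRingType) (S T : set R) :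
  S `<=` ideal_gen T -> ideal_gen S `<=` ideal_gen T.
Proof.
move=> ST _ [s [Ss ->]]; apply: ideal_gen_sum => p /Ss/ST.
exact: ideal_genM.
Qed.

Lemma ideal_gen_vanish (R R' : comNzRingType) (phi : {rmorphism R -> R'})
    (S : set R) :
  (forall g, S g -> phi g = 0) -> forall f, ideal_gen S f -> phi f = 0.
Proof.
move=> S0 _ [s [Ss ->]]; rewrite rmorph_sum big1_seq //= => p /Ss/S0 p0.
by rewrite rmorphM /= p0 mulr0.
Qed.

Lemma ideal_gen_subrX (R : comNzRingType) (S : set R) (f g : R) n :
  ideal_gen S (f - g) -> ideal_gen S (f ^+ n - g ^+ n).
Proof. by move=> Sfg; rewrite subrXX mulrC; apply: ideal_genM. Qed.

(** * Toric ideals *)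

Lemma adegD n (a : n.-tuple nat) u v : adeg a (u + v) = (adeg a u + adeg a v)%N.
Proof.
by rewrite /adeg -big_split; apply: eq_bigr => i _; rewrite mnmDE mulnDl.
Qed.

Lemma adeg_eq0 n (a : n.-tuple nat) u :
  0%N \notin tval a -> adeg a u = 0%N -> u = 0%MM.
Proof.
move=> a0 /eqP; rewrite sum_nat_eq0 => /forallP u0; apply/mnmP => i.
move: (u0 i); rewrite implyTb muln_eq0 mnm0E => /orP[/eqP //|/eqP ai0].
by rewrite -ai0 mem_tnth in a0.
Qed.

Lemma adeg_le_eq n (a : n.-tuple nat) u v :
  0%N \notin tval a -> (u <= v)%MM -> adeg a u = adeg a v -> u = v.
Proof.
move=> a0 /submK <- /eqP; rewrite adegD -{1}[adeg a u]add0n eqn_add2r.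
by move/eqP/esym/(adeg_eq0 a0) ->; rewrite add0m.
Qed.

Lemma mdeg_le_adeg n (a : n.-tuple nat) u :
  0%N \notin tval a -> (mdeg u <= adeg a u)%N.
Proof.
move=> a0; rewrite mdegE leq_sum // => i _; rewrite leq_pmulr // lt0n.
by apply: contra a0 => /eqP <-; apply: mem_tnth.
Qed.

Lemma binomN (K : fieldType) n (u v : 'X_{1..n}) : - binom K u v = binom K v u.
Proof. by rewrite /binom opprB. Qed.

Lemma binom_eq0 (K : fieldType) n (u v : 'X_{1..n}) :
  (binom K u v == 0) = (u == v).
Proof.
apply/eqP/eqP => [|->]; last by rewrite /binom subrr.
move/(congr1 (mcoeff u))/eqP; rewrite mcoeffB !mcoeffX mcoeff0 eqxx.
by case: (v =P u) => [-> //|_]; rewrite subr0 oner_eq0.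
Qed.

Lemma mem_msupp_binom (K : fieldType) n (u v w : 'X_{1..n}) : u != v ->
  (w \in msupp (binom K u v)) = (w == u) || (w == v).
Proof.
move=> uv; rewrite mcoeff_msupp mcoeffB !mcoeffX ![_ == w]eq_sym.
case: (w =P u) => [->|_]; first by rewrite (negbTE uv) mulr0n subr0 oner_eq0.
by case: (w == v); rewrite ?subrr ?eqxx // mulr0n sub0r oppr_eq0 oner_eq0.
Qed.

(** The substitution x_i -> t^{a_i}. As it vanishes on the toric ideal, it tells
    which binomials belong to the ideal, and shows that the coefficients of a
    member of the ideal sum to zero on each fiber. *)
Definition weight_subst (K : fieldType) n (a : n.-tuple nat) :
    {mpoly K[n]} -> {poly K} :=
  mmap polyC (fun i => 'X^(tnth a i)).

Lemma weight_substX (K : fieldType) n (a : n.-tuple nat) m :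
  mmap1 (fun i => 'X^(tnth a i) : {poly K}) m = 'X^(adeg a m).
Proof.
rewrite /mmap1 /adeg -prodrXr; apply: eq_bigr => i _.
by rewrite -exprM mulnC.
Qed.

Lemma weight_subst_toric (K : fieldType) n (a : n.-tuple nat) f :
  toric_ideal a f -> weight_subst (K := K) a f = 0.
Proof.
apply: (ideal_gen_vanish (phi := mmap polyC (fun i => 'X^(tnth a i)))).
move=> g [u [v [uv ->]]].
by rewrite rmorphB /= !mmapX !weight_substX uv subrr.
Qed.

Lemma toric_binomP (K : fieldType) n (a : n.-tuple nat) u v :
  toric_ideal a (binom K u v) <-> adeg a u = adeg a v.
Proof.
split=> [/weight_subst_toric|uv]; last by apply: mem_ideal_gen; exists u, v.
rewrite /weight_subst mmapB !mmapX !weight_substX.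
move/(congr1 (coefp (adeg a u)))/eqP; rewrite /= coefB !coefXn coef0 eqxx.
by case: (_ =P adeg a v) => // _; rewrite subr0 oner_eq0.
Qed.

Lemma toric_fiber_sum (K : fieldType) n (a : n.-tuple nat) f d :
  toric_ideal a f -> \sum_(m <- msupp f | adeg a m == d) (f@_m : K) = 0.
Proof.
move=> /weight_subst_toric/(congr1 (coefp d)).
rewrite /= coef0 coef_sum => sum0.
rewrite -[RHS]sum0 big_mkcond; apply: eq_bigr => m _ /=.
rewrite weight_substX coefCM coefXn [d == _]eq_sym.
by case: eqP => _; rewrite ?mulr1 ?mulr0n ?mulr0.
Qed.

(** * Markov bases *)

(** The substitution x_i -> x_i t^{a_i}: the coefficient of t^d in the image of f
    is the component of f of A-degree d, and the grading comes with a ring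
    morphism for free. *)
Definition grade (K : fieldType) n (a : n.-tuple nat) :
    {mpoly K[n]} -> {poly {mpoly K[n]}} :=
  mmap (polyC \o mpolyC n (R:=K)) (fun i => ('X_i)%:P * 'X^(tnth a i)).

Lemma gradeX (K : fieldType) n (a : n.-tuple nat) m :
  grade a ('X_[m] : {mpoly K[n]}) = ('X_[m])%:P * 'X^(adeg a m).
Proof.
rewrite /grade mmapX mpolyXE_id rmorph_prod /= /adeg -prodrXr -big_split.
by apply: eq_bigr => i _; rewrite exprMn -exprM mulnC rmorphXn.
Qed.

Lemma grade_binom (K : fieldType) n (a : n.-tuple nat) u v :
  adeg a u = adeg a v ->
  grade a (binom K u v) = (binom K u v)%:P * 'X^(adeg a u).
Proof.
by move=> uv; rewrite /grade mmapB -!/(grade a _) !gradeX -uv -mulrBl -rmorphB.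
Qed.

(** Taking the component of degree [adeg a u] of a combination of the elements
    of G kills the terms whose generator has larger degree. *)
Lemma homogeneous_ideal_gen (K : fieldType) n (a : n.-tuple nat)
    (G : set {mpoly K[n]}) u v :
  (forall f, G f -> exists w z, adeg a w = adeg a z /\ f = binom K w z) ->
  adeg a u = adeg a v -> ideal_gen G (binom K u v) ->
  ideal_gen [set f | exists w z, [/\ G f, adeg a w = adeg a z,
    (adeg a w <= adeg a u)%N & f = binom K w z]] (binom K u v).
Proof.
move=> Ghom uv [s [Gs sE]].
have -> : binom K u v = (grade a (binom K u v))`_(adeg a u).
  by rewrite grade_binom // coefCM coefXn eqxx mulr1.
rewrite sE /grade rmorph_sum coef_sum; apply: ideal_gen_sum => p /Gs Gp /=.
have [w [z [wz pE]]] := Ghom _ Gp.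
rewrite rmorphM /= -!/(grade a _) pE grade_binom // mulrCA coefCM coefMXn.
rewrite mulrC; case: ltnP => wu; first by rewrite mul0r; apply: ideal_gen0.
by apply/ideal_genM/mem_ideal_gen; exists w, z; rewrite -pE.
Qed.

(** The elements of a Markov basis G of degree at most D already generate the
    ideal, because they generate each element of B; by minimality they are all
    of G. *)
Lemma markov_basis_bounded (K : fieldType) n (a : n.-tuple nat) D
    (B : set {mpoly K[n]}) :
  (forall f, B f -> exists w z,
     [/\ adeg a w = adeg a z, (adeg a w <= D)%N & f = binom K w z]) ->
  ideal_gen B = toric_ideal a ->
  universal_markov a `<=` [set f | exists u v,
     [/\ adeg a u = adeg a v, (adeg a u <= D)%N & f = binom K u v]].
Proof.
move=> Bdeg BI f [G [Gbin GI Gmin] Gf].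
have Ghom g : G g -> exists w z, adeg a w = adeg a z /\ g = binom K w z.
  move=> /Gbin[Ig [u [v gE]]]; exists u, v; split=> //.
  by apply/(toric_binomP K); rewrite -gE.
pose H := [set g | G g /\ exists w z,
  [/\ adeg a w = adeg a z, (adeg a w <= D)%N & g = binom K w z]].
suff HG : H = G by move: Gf; rewrite -HG => -[].
apply: Gmin => [g [] //|]; rewrite eqEsubset; split.
  by rewrite -GI; apply: ideal_gen_sub => g [Gg _]; apply: mem_ideal_gen.
rewrite -BI; apply: ideal_gen_sub => g Bg.
have [w [z [wz wD gE]]] := Bdeg _ Bg; rewrite gE.
have Gwz : ideal_gen G (binom K w z) by rewrite GI; apply/toric_binomP.
have := homogeneous_ideal_gen Ghom wz Gwz.
apply: ideal_gen_sub => g' [w' [z' [Gg' wz' w'w gE']]].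
apply: mem_ideal_gen; split => //; exists w', z'; split=> //.
exact: leq_trans wD.
Qed.

Lemma finite_bounded_binoms (K : fieldType) n (a : n.-tuple nat) D :
  0%N \notin tval a ->
  finite_set [set f | exists u v,
     [/\ adeg a u = adeg a v, (adeg a u <= D)%N & f = binom K u v]].
Proof.
move=> a0; pose F (p : 'X_{1..n < D.+1} * 'X_{1..n < D.+1}) := binom K p.1 p.2.
apply: (sub_finite_set _ (finite_image F (@finite_finset _ setT))).
move=> _ [u [v [uv uD ->]]].
have uD1 : (mdeg u < D.+1)%N by rewrite ltnS (leq_trans (mdeg_le_adeg u a0)).
have vD1 : (mdeg v < D.+1)%N.
  by rewrite ltnS (leq_trans (mdeg_le_adeg v a0)) // -uv.
by exists (BMultinom uD1, BMultinom vD1).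
Qed.

(** * Reduced Groebner bases *)

(** The monomials of the initial ideal of I, when I is an ideal. *)
Definition lead_mem (K : fieldType) n (le : rel 'X_{1..n})
    (I : set {mpoly K[n]}) (m : 'X_{1..n}) : Prop :=
  exists2 f, I f & leading le f m.

Lemma leading_inj (K : fieldType) n (le : rel 'X_{1..n}) (f : {mpoly K[n]}) u v :
  monomial_order le -> leading le f u -> leading le f v -> u = v.
Proof.
by move=> [anti _ _ _ _] [fu uP] [fv vP]; apply: anti; rewrite uP // vP.
Qed.

Lemma leading_exists (K : fieldType) n (le : rel 'X_{1..n}) (f : {mpoly K[n]}) :
  monomial_order le -> f != 0 -> exists m, leading le f m.
Proof.
move=> [_ tr tot _ _]; rewrite -msupp_eq0 /leading.
elim: (msupp f : seq _) => [//|m s IHs] _; case: s IHs => [_|m' s /(_ isT)].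
  exists m; rewrite mem_head; split=> // m'; rewrite inE => /eqP ->.
  by have := tot m m; rewrite orbb.
set t := _ :: s => -[p [tp pmax]].
case/orP: (tot m p) => mp.
  exists p; split=> [|q]; rewrite inE ?tp ?orbT //.
  by case/orP=> [/eqP ->|/pmax].
exists m; split=> [|q]; rewrite inE ?eqxx // => /orP[/eqP ->|/pmax qp].
  by have := tot m m; rewrite orbb.
exact: tr mp.
Qed.

Lemma monomial_order_dvd n (le : rel 'X_{1..n}) u v :
  monomial_order le -> (u <= v)%MM -> le u v.
Proof.
move=> [_ _ _ le0 leD] /submK <-; rewrite -{1}[u]add0m.
exact: leD.
Qed.

Lemma toric_lead_binom (K : fieldType) n (a : n.-tuple nat)
    (le : rel 'X_{1..n}) u v :
  monomial_order le -> u != v -> adeg a u = adeg a v ->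
  lead_mem le (@toric_ideal K n a) u \/ lead_mem le (@toric_ideal K n a) v.
Proof.
move=> ord_le uv auv.
have [m Lm] : exists m, leading le (binom K u v) m.
  by apply: leading_exists; rewrite ?binom_eq0.
have Iuv : toric_ideal a (binom K u v) by apply/toric_binomP.
have := Lm.1; rewrite mem_msupp_binom // => /orP[] /eqP mE;
  [left|right]; by rewrite mE in Lm; exists (binom K u v).
Qed.

(** Some term of a combination equal to x^m contains the monomial m. *)
Lemma monomial_ideal_dvd (K : fieldType) n (P : set 'X_{1..n}) m :
  ideal_gen [set g | exists2 s, P s & g = 'X_[s] :> {mpoly K[n]}] 'X_[m] ->
  exists2 s, P s & (s <= m)%MM.
Proof.
move=> [r [Pr mE]].
have : (\sum_(p <- r) p.1 * p.2)@_m != 0 by rewrite -mE mcoeffX eqxx oner_eq0.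
rewrite raddf_sum /= => rm.
have [p rp pm] : exists2 p, p \in r & (p.1 * p.2)@_m != 0.
  apply: contrapT => nex; case/eqP: rm; apply: big1_seq => p /andP[_ rp].
  by apply/eqP; apply: contrapT => /negP pm; apply: nex; exists p.
have [s Ps pE] := Pr _ rp; exists s => //; move: pm.
rewrite -mcoeff_msupp pE (perm_mem (msuppMX _ _)) => /mapP[q _ ->].
exact: lem_addr.
Qed.

Lemma groebner_basis_dvd (K : fieldType) n (le : rel 'X_{1..n})
    (I G : set {mpoly K[n]}) m :
  groebner_basis le I G -> lead_mem le I m ->
  exists g s, [/\ G g, leading le g s & (s <= m)%MM].
Proof.
move=> [_ _ inGI] [f If fm].
have : initial_ideal le G 'X_[m].
  by rewrite inGI; apply: mem_ideal_gen; exists f, m.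
rewrite /initial_ideal => inGm.
have [s [g Gg gs] sm] : exists2 s, lead_mem le G s & (s <= m)%MM.
  apply: (@monomial_ideal_dvd K); move: inGm; apply: ideal_gen_sub.
  by move=> _ [g [s [Gg gs ->]]]; apply: mem_ideal_gen; exists s => //; exists g.
by exists g, s.
Qed.

(** The element f of a reduced Groebner basis has a leading monomial m that is
    minimal in the initial ideal, and all its other monomials are standard.
    Since the coefficients of f sum to zero on the fiber of m, some other
    monomial m' of f has the degree of m. Then f - (x^m - x^m') lies in the toric
    ideal and has only standard monomials, so it is zero. *)
Lemma universal_groebner_binom (K : fieldType) n (a : n.-tuple nat)
    (f : {mpoly K[n]}) :
  universal_groebner a f ->
  exists (le : rel 'X_{1..n}) m m', let L := lead_mem le (@toric_ideal K n a) in
    [/\ monomial_order le, f = binom K m m', m != m' /\ adeg a m = adeg a m',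
        forall s, (s <= m)%MM -> L s -> s = m
      & forall s, (s <= m')%MM -> ~ L s].
Proof.
move=> [le [G [ord_le [GB monic red] Gf]]].
have [m [fm fm1]] := monic _ Gf.
have If : toric_ideal a f by case: GB => _ GI _; apply: GI.
have minm s : (s <= m)%MM -> lead_mem le (@toric_ideal K n a) s -> s = m.
  move=> sm /(groebner_basis_dvd GB)[g [t [Gg gt ts]]].
  case: (pselect (g = f)) => [gf|gf]; last first.
    by have := red _ _ _ _ Gg Gf gf gt fm.1; rewrite (lepm_trans ts sm).
  move: gt; rewrite gf => /(leading_inj ord_le fm) mt.
  apply/mnmP => i; apply/eqP; rewrite eqn_leq (mnm_lepP sm).
  by rewrite mt (mnm_lepP ts).
have std x s : x \in msupp f -> x != m -> (s <= x)%MM ->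
    ~ lead_mem le (@toric_ideal K n a) s.
  move=> fx xm sx /(groebner_basis_dvd GB)[g [t [Gg gt ts]]].
  have tx := lepm_trans ts sx; case: (pselect (g = f)) => [gf|gf]; last first.
    by have := red _ _ _ _ Gg Gf gf gt fx; rewrite tx.
  move: gt; rewrite gf => /(leading_inj ord_le fm) mt.
  case/eqP: xm; have [anti _ _ _ _] := ord_le; apply: anti.
  by rewrite fm.2 //= mt monomial_order_dvd.
have [m' [fm' m'm adm]] : exists m', [/\ m' \in msupp f, m' != m
    & adeg a m' = adeg a m].
  apply: contrapT => nex; move: (toric_fiber_sum (adeg a m) If).
  rewrite big_mkcond (bigD1_seq m) ?fm.1 ?msupp_uniq //= eqxx fm1.
  rewrite big1_seq ?addr0; first by move/eqP; rewrite oner_eq0.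
  move=> x /andP[xm fx]; case: (adeg a x =P adeg a m) => // ax.
  by case: nex; exists x.
(* A nonzero remainder would have a leading monomial, which is standard. *)
exists le, m, m'; split=> //; [|by rewrite eq_sym | by move=> s; apply: std].
have Ig : toric_ideal a (f - binom K m m').
  by apply: ideal_genB => //; apply/toric_binomP.
apply/eqP; rewrite -subr_eq0; apply: contrapT => /negP.
case/(leading_exists ord_le) => p gp.
have := gp.1; rewrite mcoeff_msupp mcoeffB => gp0.
have [pm|pm] := eqVneq p m.
  case/eqP: gp0; rewrite pm fm1 mcoeffB !mcoeffX eqxx (negbTE m'm) mulr0n.
  by rewrite subr0 subrr.
have fp : p \in msupp f.
  rewrite mcoeff_msupp; apply: contraNneq gp0 => fp0; apply/eqP.
  have m'p : m' != p.
    by apply: contraTneq fm' => ->; rewrite mcoeff_msupp fp0 eqxx.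
  rewrite fp0 mcoeffB !mcoeffX (negbTE m'p) [m == p]eq_sym (negbTE pm) mulr0n.
  by rewrite !subr0.
by case: (std p p fp pm (lepm_refl p)); exists (f - binom K m m').
Qed.

(** * The sets {1, 2, 2k} *)

Definition weights (k : nat) : 3.-tuple nat := in_tuple [:: 1; 2; 2 * k]%N.

Definition mono (a b c : nat) : 'X_{1..3} :=
  [multinom nth 0%N [:: a; b; c] i | i < 3].

Definition i0 : 'I_3 := @Ordinal 3 0 isT.
Definition i1 : 'I_3 := @Ordinal 3 1 isT.
Definition i2 : 'I_3 := @Ordinal 3 2 isT.

Lemma ord3P (P : 'I_3 -> Prop) : P i0 -> P i1 -> P i2 -> forall i, P i.
Proof.
move=> P0 P1 P2 [[|[|[|//]]] ip].
- by rewrite (_ : Ordinal _ = i0) //; apply: val_inj.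
- by rewrite (_ : Ordinal _ = i1) //; apply: val_inj.
- by rewrite (_ : Ordinal _ = i2) //; apply: val_inj.
Qed.

Lemma monoP u : exists a b c, u = mono a b c.
Proof.
exists (u i0), (u i1), (u i2); apply/mnmP.
by apply: ord3P; rewrite mnmE.
Qed.

Lemma mono_eq a b c a' b' c' :
  (mono a b c == mono a' b' c') = [&& a == a', b == b' & c == c'].
Proof.
apply/eqP/and3P => [|[/eqP -> /eqP -> /eqP -> //]].
move/mnmP => e; move: (e i0) (e i1) (e i2); rewrite !mnmE /=.
by move=> -> -> ->; rewrite !eqxx.
Qed.

Lemma mono_le a b c a' b' c' :
  (mono a b c <= mono a' b' c')%MM = [&& a <= a', b <= b' & c <= c']%N.
Proof.
apply/mnm_lepP/and3P => [e|[la lb lc]].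
  by move: (e i0) (e i1) (e i2); rewrite !mnmE.
by apply: ord3P; rewrite !mnmE.
Qed.

Lemma mono_add a b c a' b' c' :
  (mono a b c + mono a' b' c')%MM = mono (a + a') (b + b') (c + c').
Proof. by apply/mnmP; apply: ord3P; rewrite mnmDE !mnmE. Qed.

Lemma adeg_mono k a b c :
  adeg (weights k) (mono a b c) = (a + 2 * b + 2 * k * c)%N.
Proof.
rewrite /adeg !big_ord_recl big_ord0 !mnmE /= !(tnth_nth 0%N) /=.
by rewrite muln1 addn0 addnA [(b * 2)%N]mulnC [(c * _)%N]mulnC.
Qed.

Lemma weights_neq0 k : (0 < k)%N -> 0%N \notin tval (weights k).
Proof. by rewrite !inE; lia. Qed.

(** The exponents of x^2 - y and of the binomials z - x^{2i} y^{k-i}; up to sign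
    these are all the primitive binomials. *)
Variant graver_pair (k : nat) : 'X_{1..3} -> 'X_{1..3} -> Prop :=
| Conic : graver_pair k (mono 2 0 0) (mono 0 1 0)
| Fiber i of (i <= k)%N :
    graver_pair k (mono 0 0 1) (mono (2 * i) (k - i) 0).

Lemma graver_pair_adeg k w z :
  graver_pair k w z -> adeg (weights k) w = adeg (weights k) z.
Proof. by case=> [|i ik]; rewrite !adeg_mono; lia. Qed.

Lemma graver_pair_neq k w z : graver_pair k w z -> w != z.
Proof. by case=> [|i ik]; rewrite mono_eq; lia. Qed.

(** Compare the exponents of z, then those of x. If z occurs more often in u,
    the part of v in x and y has degree at least 2k, hence is divisible by some
    x^{2i} y^{k-i}.
    If z occurs equally often, the exponents of x differ by an even number, and
    the exponents of y differ the other way. *)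
Lemma graver_pair_exists k u v :
  u != v -> adeg (weights k) u = adeg (weights k) v ->
  exists w z, [/\ graver_pair k w z \/ graver_pair k z w,
                  (w <= u)%MM & (z <= v)%MM].
Proof.
have [a [b [c ->]]] := monoP u; have [a' [b' [c' ->]]] := monoP v.
move=> uv; rewrite !adeg_mono => auv.
wlog : a b c a' b' c' uv auv / (c' < c)%N \/ c' = c /\ (a' < a)%N => [th|].
  have [lt|gt|cc] := ltngtP c' c; first by apply: th => //; left.
    have [|||w [z [wz wu zv]]] := th a' b' c' a b c _ _ _; rewrite 1?eq_sym //.
      by left.
    by exists z, w; split=> //; case: wz; [right|left].
  have [lt|gt|aa] := ltngtP a' a; first by apply: th => //; right.
    have [|||w [z [wz wu zv]]] := th a' b' c' a b c _ _ _; rewrite 1?eq_sym //.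
      by right.
    by exists z, w; split=> //; case: wz; [right|left].
  by move: uv auv; rewrite mono_eq aa cc !eqxx; lia.
move=> [lt|[cc lt]].
  (* The divisor of v with as many factors x^2 as possible. *)
  exists (mono 0 0 1), (mono (2 * minn (a'./2) k) (k - minn (a'./2) k) 0).
  split; first by left; apply: Fiber; lia.
    by rewrite mono_le; lia.
  have [e ce] : exists e, c = (c' + e).+1 by exists (c - c').-1; lia.
  by rewrite mono_le; move: auv; rewrite ce mulnS mulnDr; lia.
exists (mono 2 0 0), (mono 0 1 0); split; first by left; apply: Conic.
  by rewrite mono_le; move: auv; rewrite cc; lia.
by rewrite mono_le; move: auv; rewrite cc; lia.
Qed.

(** Modulo S, y = x^2 and therefore z = x^{2i} y^{k-i} = x^{2k}, so each monomial
    is congruent to the power of x of the same degree. *)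
Lemma toric_pair_generated (K : fieldType) k i (S : set {mpoly K[3]}) :
  (i <= k)%N -> ideal_gen S (binom K (mono 2 0 0) (mono 0 1 0)) ->
  ideal_gen S (binom K (mono 0 0 1) (mono (2 * i) (k - i) 0)) ->
  forall u v, adeg (weights k) u = adeg (weights k) v ->
  ideal_gen S (binom K u v).
Proof.
move=> ik Sxy Sz.
pose x : {mpoly K[3]} := 'X_[mono 1 0 0].
pose y : {mpoly K[3]} := 'X_[mono 0 1 0].
pose z : {mpoly K[3]} := 'X_[mono 0 0 1].
have monoE a b c : 'X_[mono a b c] = x ^+ a * y ^+ b * z ^+ c.
  rewrite !mpolyXn -!mpolyXD; congr 'X_[_]; apply/mnmP.
  by apply: ord3P; rewrite !(mnmDE, mulmnE, mnmE) /=; lia.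
have yx : ideal_gen S (y - x ^+ 2).
  rewrite -[y - _]opprB -mulN1r; apply: ideal_genM.
  by move: Sxy; rewrite /binom !monoE !expr0 !expr1 !mulr1 mul1r.
have yxX n : ideal_gen S (y ^+ n - x ^+ (2 * n)).
  by rewrite exprM; apply: ideal_gen_subrX.
have zx : ideal_gen S (z - x ^+ (2 * k)).
  rewrite -(subrK (x ^+ (2 * i) * y ^+ (k - i)) z) -addrA; apply: ideal_genD.
    by move: Sz; rewrite /binom !monoE !expr0 !expr1 !mulr1 !mul1r.
  have -> : (2 * k = 2 * i + 2 * (k - i))%N by lia.
  by rewrite exprD -mulrBr; apply: ideal_genM.
have nf u : ideal_gen S ('X_[u] - x ^+ (adeg (weights k) u)).
  have [a [b [c ->]]] := monoP u; rewrite monoE adeg_mono.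
  rewrite (exprD x (a + 2 * b)) (exprD x a).
  rewrite -[X in X - _](subrK (x ^+ a * x ^+ (2 * b) * z ^+ c)) -addrA.
  apply: ideal_genD.
    by rewrite -mulrBl -mulrBr mulrC; do 2 apply: ideal_genM.
  rewrite -mulrBr; apply: ideal_genM; rewrite [x ^+ (_ * c)]exprM.
  exact: ideal_gen_subrX.
move=> u v uv; have := ideal_genB (nf u) (nf v).
by rewrite uv opprB addrA subrK.
Qed.

Lemma toric_generated (K : fieldType) k i : (i <= k)%N ->
  ideal_gen [set binom K (mono 2 0 0) (mono 0 1 0);
                 binom K (mono 0 0 1) (mono (2 * i) (k - i) 0)] =
  toric_ideal (weights k).
Proof.
move=> ik; rewrite eqEsubset; split; apply: ideal_gen_sub.
  move=> _ [->|->]; apply/toric_binomP/(@graver_pair_adeg k).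
    exact: Conic.
  exact: Fiber.
move=> _ [u [v [uv ->]]]; apply: (toric_pair_generated ik) uv.
  by apply: mem_ideal_gen; left.
by apply: mem_ideal_gen; right.
Qed.

(** * Lower bounds: Graver and Markov bases *)

Definition fiber_binom (K : fieldType) (k i : nat) : {mpoly K[3]} :=
  binom K (mono 0 0 1) (mono (2 * i) (k - i) 0).

(** A primitive binomial equals the one given by [graver_pair_exists], whose
    degree is 2 or 2k. *)
Lemma graver_sub_bounded (K : fieldType) k : (0 < k)%N ->
  @graver K _ (weights k) `<=` [set f | exists u v,
    [/\ adeg (weights k) u = adeg (weights k) v,
        (adeg (weights k) u <= 2 * k)%N & f = binom K u v]].
Proof.
move=> k0 _ [u [v [-> [/toric_binomP uv]]]]; rewrite binom_eq0 => neq prim.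
have [w [z [wz wu zv]]] := graver_pair_exists neq uv.
have awz : adeg (weights k) w = adeg (weights k) z.
  by case: wz => /graver_pair_adeg.
exists w, z; split=> //.
  by case: wz => -[|i ik] in awz *; rewrite ?adeg_mono; lia.
apply/esym/prim => //; first exact/toric_binomP.
by rewrite binom_eq0; case: wz => /graver_pair_neq //; rewrite eq_sym.
Qed.

(** A monomial dividing z is 1 or z, and 1 is alone in its degree. *)
Lemma fiber_binom_graver (K : fieldType) k i : (0 < k)%N -> (i <= k)%N ->
  @graver K _ (weights k) (fiber_binom K k i).
Proof.
move=> k0 ik; pose wz := Fiber ik.
exists (mono 0 0 1), (mono (2 * i) (k - i) 0); split=> //; split.
- exact/toric_binomP/graver_pair_adeg.
- by rewrite binom_eq0 (graver_pair_neq wz).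
move=> w z /toric_binomP wz'; rewrite binom_eq0 => neq wle zle.
have w1 : w = mono 0 0 1.
  have [a [b [c wE]]] := monoP w; move: wle; rewrite wE mono_le.
  case/and3P; rewrite !leqn0 leq_eqVlt ltnS leqn0.
  move=> /eqP a0 /eqP b0 /orP[/eqP c1|/eqP c0]; first by rewrite a0 b0 c1.
  have w0 : adeg (weights k) w = 0%N by rewrite wE a0 b0 c0 adeg_mono; lia.
  move: neq; rewrite (adeg_eq0 (weights_neq0 k0) w0).
  by rewrite (adeg_eq0 (weights_neq0 k0) (etrans (esym wz') w0)) eqxx.
rewrite w1; congr binom; apply: (adeg_le_eq (weights_neq0 k0) zle).
by rewrite -wz' w1 (graver_pair_adeg wz).
Qed.

Lemma markov_sub_bounded (K : fieldType) k : (0 < k)%N ->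
  @universal_markov K _ (weights k) `<=` [set f | exists u v,
    [/\ adeg (weights k) u = adeg (weights k) v,
        (adeg (weights k) u <= 2 * k)%N & f = binom K u v]].
Proof.
move=> k0; apply: markov_basis_bounded (toric_generated K (leq0n k)).
move=> _ [->|->].
  exists (mono 2 0 0), (mono 0 1 0); split=> //.
    exact/graver_pair_adeg/Conic.
  by rewrite adeg_mono; lia.
exists (mono 0 0 1), (mono (2 * 0) (k - 0) 0); split=> //.
  exact/graver_pair_adeg/Fiber.
by rewrite adeg_mono; lia.
Qed.

Lemma mevalX_mono (K : fieldType) (t : 'I_3 -> K) a b c :
  ('X_[mono a b c]).@[t] = t i0 ^+ a * t i1 ^+ b * t i2 ^+ c.
Proof.
rewrite mevalX !big_ord_recl big_ord0 !mnmE /= mulr1 mulrA.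
by congr (t _ ^+ _ * t _ ^+ _ * t _ ^+ _); apply: val_inj.
Qed.

(** Minimality is checked by evaluation. The binomial z - x^{2i} y^{k-i}
    vanishes at (0, 1, 0^{2i}), where x^2 - y takes the value -1; conversely
    x^2 - y vanishes at (1, 1, 0), where the other binomial equals -1. *)
Lemma fiber_binom_markov (K : fieldType) k i : (0 < k)%N -> (i <= k)%N ->
  @universal_markov K _ (weights k) (fiber_binom K k i).
Proof.
move=> k0 ik; set g := fiber_binom K k i.
pose q := binom K (mono 2 0 0) (mono 0 1 0).
exists [set q; g]; last by right.
split=> [f qgf||H sub HI].
- split.
    by rewrite -(toric_generated K ik); apply: mem_ideal_gen.
  by case: qgf => ->; [exists (mono 2 0 0), (mono 0 1 0)|
     exists (mono 0 0 1), (mono (2 * i) (k - i) 0)].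
- exact: toric_generated.
have HI' f : [set q; g] f -> ideal_gen H f.
  by move=> qgf; rewrite HI -(toric_generated K ik); apply: mem_ideal_gen.
have vanish (t : 'I_3 -> K) := ideal_gen_vanish (phi := meval t) (S := H).
apply/seteqP; split=> // f [->|->]; apply: contrapT => notH.
  pose t (j : 'I_3) : K := nth 0 [:: 0; 1; 0 ^+ (2 * i)] j.
  have /eqP : q.@[t] = 0.
    apply: (vanish t _ q); last by apply: HI'; left.
    move=> h Hh; case: (sub _ Hh) => hE; first by rewrite -hE in notH.
    rewrite hE /= /g /fiber_binom /binom mevalB !mevalX_mono /t /=.
    by rewrite !expr0 expr1 expr1n !mulr1 mul1r subrr.
  rewrite /q /binom mevalB !mevalX_mono /t /=.
  by rewrite !expr0 expr1 expr0n !mul0r !mulr1 sub0r oppr_eq0 oner_eq0.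
pose t (j : 'I_3) : K := nth 0 [:: 1; 1; 0] j.
have /eqP : g.@[t] = 0.
  apply: (vanish t _ g); last by apply: HI'; right.
  move=> h Hh; case: (sub _ Hh) => hE; last by rewrite -hE in notH.
  rewrite hE /= /q /binom mevalB !mevalX_mono /t /=.
  by rewrite !expr1n !expr0 subrr.
rewrite /g /fiber_binom /binom mevalB !mevalX_mono /t /=.
by rewrite !expr1n expr0 expr1 mulr0 !mulr1 sub0r oppr_eq0 oner_eq0.
Qed.

(** * Upper bounds: universal Groebner basis and circuits *)

(** For j < 3 these are x^2 - y, z - y^k and z - x^{2k}, the binomials of
    [graver_pair] in two variables. *)
Definition pure_binom (K : fieldType) (k j : nat) : {mpoly K[3]} :=
  nth 0 [:: binom K (mono 2 0 0) (mono 0 1 0); fiber_binom K k 0;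
            fiber_binom K k k] j.

Definition pure_upto_sign (K : fieldType) (k : nat) : set {mpoly K[3]} :=
  [set f | exists2 j, (j < 3)%N &
    f = pure_binom K k j \/ f = - pure_binom K k j].

Lemma pure_pair (K : fieldType) k w z :
  graver_pair k w z ->
  (forall i, (0 < i < k)%N -> z <> mono (2 * i) (k - i) 0) ->
  pure_upto_sign k (binom K w z) /\ pure_upto_sign k (binom K z w).
Proof.
move=> wz ends; rewrite -(binomN K w z).
suff [j j3 ->] : exists2 j, (j < 3)%N & binom K w z = pure_binom K k j.
  by split; exists j => //; [left|right].
case: wz ends => [|i ik] ends; first by exists 0%N.
have [i0|ipos] := posnP i; first by exists 1%N; rewrite // i0.
have [ik'|ik'|ik'] := ltngtP i k; last by exists 2; rewrite // ik'.
  by case: (ends i); rewrite // ipos.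
by move: ik; rewrite leqNgt ik'.
Qed.

(** The pair (w, z) below the terms (m, m') of f consists of m and m' themselves:
    z divides the standard m', so w is the leading term of w - z and, dividing
    the minimal m, equals it; then z and m' have the same degree. *)
Lemma universal_groebner_pure (K : fieldType) k : (0 < k)%N ->
  @universal_groebner K _ (weights k) `<=` pure_upto_sign k.
Proof.
move=> k0 f /universal_groebner_binom.
move=> [le [m [m' [ord_le -> [mm' am] minm std]]]].
have [w [z [wz wm zm']]] := graver_pair_exists mm' am.
have awz : adeg (weights k) w = adeg (weights k) z.
  by case: wz => /graver_pair_adeg.
have neq : w != z by case: wz => /graver_pair_neq //; rewrite eq_sym.
have wE : w = m.
  case: (toric_lead_binom K ord_le neq awz) => [|/(std _ zm')//].
  exact: minm.
have zE : z = m'.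
  by apply: (adeg_le_eq (weights_neq0 k0) zm'); rewrite -awz wE.
rewrite wE zE in wz.
have ends i : (0 < i < k)%N ->
    m <> mono (2 * i) (k - i) 0 /\ m' <> mono (2 * i) (k - i) 0.
  move=> ik; have xy_lead := toric_lead_binom K ord_le
    (graver_pair_neq (Conic k)) (graver_pair_adeg (Conic k)).
  have xle : (mono 2 0 0 <= mono (2 * i) (k - i) 0)%MM by rewrite mono_le; lia.
  have yle : (mono 0 1 0 <= mono (2 * i) (k - i) 0)%MM by rewrite mono_le; lia.
  split=> mE; move: minm std; rewrite mE => minm std.
    by case: xy_lead => [/(minm _ xle)|/(minm _ yle)]/eqP; rewrite mono_eq; lia.
  by case: xy_lead => [/(std _ xle)|/(std _ yle)].
case: wz => wz.
  by case: (pure_pair K wz (fun i ik => (ends i ik).2)).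
by case: (pure_pair K wz (fun i ik => (ends i ik).1)).
Qed.

Lemma big_gcdn3 (F : 'I_3 -> nat) :
  \big[gcdn/0%N]_(i < 3 | F i != 0%N) F i = gcdn (F i0) (gcdn (F i1) (F i2)).
Proof.
rewrite big_mkcond /= !big_ord_recl big_ord0 gcdn0.
have if0 (n : nat) : (if n != 0 then n else 0)%N = n by case: n.
by rewrite !if0; congr (gcdn (F _) (gcdn (F _) (F _))); apply: val_inj.
Qed.

(** Minimality of the support is used pointwise. Against x^2 - y it excludes the
    pairs with 0 < i < k and removes z in the conic case; against z - y^k and
    z - x^{2k} it removes the third variable. Then (u, v) is a multiple of
    (w, z), and the multiplier divides all the exponents, whose gcd is 1. *)
Lemma circuit_graver_pair k u v w z : (0 < k)%N ->
  adeg (weights k) u = adeg (weights k) v ->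
  (forall i, u i = 0%N \/ v i = 0%N) ->
  \big[gcdn/0%N]_(i < 3 | (u + v)%MM i != 0%N) (u + v)%MM i = 1%N ->
  (forall s t, adeg (weights k) s = adeg (weights k) t -> s != t ->
    (forall i, u i + v i = 0 -> s i + t i = 0)%N ->
    (forall i, s i + t i = 0 -> u i + v i = 0)%N) ->
  graver_pair k w z -> (w <= u)%MM -> (z <= v)%MM ->
  [/\ w = u, z = v & forall i, (0 < i < k)%N -> z <> mono (2 * i) (k - i) 0].
Proof.
have [a [b [c ->]]] := monoP u; have [a' [b' [c' ->]]] := monoP v.
move=> k0 uv dis; rewrite mono_add big_gcdn3 !mnmE /= => gcd1 mins wz.
move: uv (dis i0) (dis i1) (dis i2); rewrite !adeg_mono !mnmE /= => uv da db dc.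
have {}mins s0 s1 s2 t0 t1 t2 : (s0 + 2 * s1 + 2 * k * s2 =
      t0 + 2 * t1 + 2 * k * t2)%N -> ~~ [&& s0 == t0, s1 == t1 & s2 == t2] ->
    (a + a' = 0 -> s0 + t0 = 0)%N -> (b + b' = 0 -> s1 + t1 = 0)%N ->
    (c + c' = 0 -> s2 + t2 = 0)%N -> [/\ (s0 + t0 = 0 -> a + a' = 0)%N,
      (s1 + t1 = 0 -> b + b' = 0)%N & (s2 + t2 = 0 -> c + c' = 0)%N].
  move=> st neq z0 z1 z2.
  have := mins (mono s0 s1 s2) (mono t0 t1 t2); rewrite !adeg_mono mono_eq.
  move=> /(_ st neq) ssub; have {}ssub i := ssub (ord3P _ _ _) i.
  have {}ssub i : (mono s0 s1 s2 i + mono t0 t1 t2 i)%N = 0%N ->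
      (mono a b c i + mono a' b' c' i)%N = 0%N.
    by apply: ssub; rewrite !mnmE.
  by split; [move: (ssub i0)|move: (ssub i1)|move: (ssub i2)];
    rewrite !mnmE; apply.
have supp_xy : (0 < a + a')%N -> (0 < b + b')%N -> (c + c' = 0)%N.
  by move=> a0 b0; have [||||| _ _ /(_ erefl)] := mins 2 0 0 0 1 0; lia.
case: wz => [|i ik]; rewrite !mono_le => /and3P[wa wb wc] /and3P[za zb zc].
  have cc : (c + c' = 0)%N by apply: supp_xy; lia.
  have b1 : b' = 1%N.
    move: gcd1; have -> : (c + c' = 0)%N by [].
    have -> : (b + b' = b')%N by lia.
    have -> : (a + a' = b' * 2)%N by lia.
    by rewrite gcdn0 gcdnC gcdnMr.
  split; [| |move=> j jk]; apply/eqP; rewrite mono_eq; lia.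
have [i0'|ipos] := posnP i.
  have aa : (a + a' = 0)%N.
    by have [||||| /(_ erefl)] := mins 0 0 1 0 k 0; lia.
  have bkc : b' = (k * c)%N by lia.
  have c1 : c = 1%N.
    move: gcd1; rewrite aa; have -> : (c + c' = c)%N by lia.
    have -> : (b + b' = c * k)%N by lia.
    by rewrite gcd0n gcdnC gcdnMr.
  rewrite i0'; split; [| |move=> j jk]; apply/eqP; rewrite mono_eq; lia.
have [ilt|ige] := ltnP i k.
  by have : (c + c' = 0)%N by [apply: supp_xy; lia]; lia.
have {ik ige} ik : i = k by lia.
have bb : (b + b' = 0)%N.
  by have [||||| _ /(_ erefl)] := mins 0 0 1 (2 * k) 0 0; lia.
have c1 : c = 1%N.
  move: gcd1; rewrite bb; have -> : (c + c' = c)%N by lia.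
  have -> : (a + a' = c * (2 * k))%N by lia.
  by rewrite gcd0n gcdnC gcdnMr.
rewrite ik; split; [| |move=> j jk]; apply/eqP; rewrite mono_eq; lia.
Qed.

Lemma circuits_pure (K : fieldType) k : (0 < k)%N ->
  @circuits K _ (weights k) `<=` pure_upto_sign k.
Proof.
move=> k0 f [u [v [-> [/toric_binomP uv dis gcd1] smin]]].
have disj i : u i = 0%N \/ v i = 0%N.
  move: dis; rewrite disjoint_subset => /fintype.subsetP /(_ i).
  rewrite !inE; case: eqP => [|_ /(_ isT)]; first by left.
  by rewrite negbK => /eqP; right.
have neq : u != v.
  apply/eqP => uE; move: gcd1; rewrite big_pred0 // => i; apply/negbTE.
  rewrite negbK mnmDE addn_eq0.
  by case: (disj i); rewrite uE => ->; rewrite eqxx.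
have mins s t : adeg (weights k) s = adeg (weights k) t -> s != t ->
    (forall i, u i + v i = 0 -> s i + t i = 0)%N ->
    (forall i, s i + t i = 0 -> u i + v i = 0)%N.
  move=> st neqst ssub i sti.
  have Ist : toric_ideal (weights k) (binom K s t) by apply/toric_binomP.
  have := smin s t Ist; rewrite binom_eq0 => /(_ neqst).
  apply: contraNeq => uvi; apply/properP; split.
    by apply/fintype.subsetP => j; move: (ssub j); rewrite !inE; lia.
  by exists i; rewrite !inE; lia.
have [w [z [[wz|wz] wu zv]]] := graver_pair_exists neq uv.
  have [<- <- ends] := circuit_graver_pair k0 uv disj gcd1 mins wz wu zv.
  by case: (pure_pair K wz ends).
have [||s t st neqst ssub i|<- <- ends] :=
    circuit_graver_pair k0 (esym uv) _ _ _ wz zv wu.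
- by move=> i; case: (disj i); [right|left].
- by rewrite addmC.
- move=> sti; rewrite addnC; apply: (mins s t) sti => // j.
  by rewrite addnC; apply: ssub.
by case: (pure_pair K wz ends).
Qed.

(** * Sizes *)

Lemma pure_card_le (K : fieldType) k (S : set {mpoly K[3]}) :
  S `<=` pure_upto_sign k ->
  ([set ([set f; - f] : set {mpoly K[3]}) | f in S] #<= `I_3)%card.
Proof.
move=> Spure.
pose F j : set {mpoly K[3]} := [set pure_binom K k j; - pure_binom K k j].
apply: card_le_trans (card_image_le F `I_3); apply: subset_card_le.
move=> _ [f /Spure[j j3 fE] <-]; exists j => //.
by case: fE => ->; rewrite /F ?opprK // setUC.
Qed.

(** Distinct i give binomials that differ even up to sign: the support of
    z - x^{2i} y^{k-i} determines i. *)
Lemma fiber_size_gt (K : fieldType) k (S : set {mpoly K[3]}) x :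
  (forall i, (i <= k)%N -> S (fiber_binom K k i)) -> size_upto_sign S x ->
  (k < x)%N.
Proof.
move=> Sfib Sx; rewrite -card_le_II -(card_le_eqr Sx).
pose F i : set {mpoly K[3]} := [set fiber_binom K k i; - fiber_binom K k i].
have Finj : {in `I_k.+1 &, injective F}.
  move=> i j; rewrite !inE /= !ltnS => ik jk ij.
  have : F i (fiber_binom K k i) by left.
  rewrite ij => mij.
  have : mono (2 * i) (k - i) 0 \in msupp (fiber_binom K k j).
    have neq := graver_pair_neq (Fiber ik).
    case: mij => e; [rewrite -e|rewrite -(perm_mem (msuppN _)) -e];
      by rewrite mem_msupp_binom // eqxx orbT.
  rewrite mem_msupp_binom; last exact: graver_pair_neq (Fiber jk).
  by rewrite !mono_eq; lia.
rewrite -(card_le_eql (inj_card_eq Finj)); apply: subset_card_le.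
by move=> _ [i ik <-]; exists (fiber_binom K k i); [apply: Sfib|].
Qed.

(** With k larger than phi 0, ..., phi 3, the set {1, 2, 2k} contradicts a bound
    by phi. *)
Lemma unbounded_size (K : fieldType)
    (X Y : forall n, n.-tuple nat -> set {mpoly K[n]}) :
  (forall k, (0 < k)%N -> X _ (weights k) `<=` [set f | exists u v,
    [/\ adeg (weights k) u = adeg (weights k) v,
        (adeg (weights k) u <= 2 * k)%N & f = binom K u v]]) ->
  (forall k i, (0 < k)%N -> (i <= k)%N -> X _ (weights k) (fiber_binom K k i)) ->
  (forall k, (0 < k)%N -> Y _ (weights k) `<=` pure_upto_sign k) ->
  ~ (exists phi, size_bounded_by X Y phi).
Proof.
move=> Xfin Xfib Ypure [phi bnd].
pose k := (phi 0 + phi 1 + phi 2 + phi 3 + 2)%N.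
have k0 : (0 < k)%N by lia.
pose A : {fset nat} := [fset 1; 2; 2 * k]%fset.
have sortA : sort leq A = [:: 1; 2; 2 * k]%N.
  apply: (sorted_eq leq_trans anti_leq) => /=; first exact/sort_sorted/leq_total.
    by rewrite /k; lia.
  rewrite perm_sort; apply: uniq_perm; first exact: fset_uniq.
    by rewrite /= !inE /k; lia.
  by move=> x; rewrite !inE orbA.
have := bnd A; rewrite /elements.
(* Generalizing the sorted list turns [elements A] into [weights k]. *)
move: (sort leq A) sortA => s -> {s} bndA.
have [x Xx] : exists x, size_upto_sign (X _ (weights k)) x.
  apply/finite_image/(sub_finite_set (Xfin k k0)).
  exact/finite_bounded_binoms/weights_neq0.
have [y Yy] : exists y, size_upto_sign (Y _ (weights k)) y.
  by apply/finite_set_leP; exists 3; apply: pure_card_le (Ypure k k0).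
have y3 : (y <= 3)%N.
  by rewrite -card_le_II -(card_le_eql Yy); apply: pure_card_le (Ypure k k0).
have := fiber_size_gt (fun i => Xfib k i k0) Xx.
have A0 : A != fset0 by apply/fset0Pn; exists 1%N; rewrite !inE.
have A0' : 0%N \notin A by rewrite !inE; lia.
have := bndA A0 A0' x y Xx Yy => + kx.
by rewrite /k in kx; case: y y3 Yy => [|[|[|[|//]]]] _ _; lia.
Qed.

Theorem corollary4p4 (K : fieldType) :
  [/\ ~ (exists phi : nat -> nat,
           size_bounded_by (@graver K) (@universal_groebner K) phi),
      ~ (exists phi : nat -> nat,
           size_bounded_by (@graver K) (@circuits K) phi),
      ~ (exists phi : nat -> nat,
           size_bounded_by (@universal_markov K) (@universal_groebner K) phi)
    & ~ (exists phi : nat -> nat,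
           size_bounded_by (@universal_markov K) (@circuits K) phi)].
Proof.
split; apply: unbounded_size.
all: by [exact: graver_sub_bounded | exact: markov_sub_bounded
  | exact: fiber_binom_graver | exact: fiber_binom_markov
  | exact: universal_groebner_pure | exact: circuits_pure].
Qed.
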